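(* Let $a_1,\dots,a_n$ be positive integers and let $\mathcal{S}=\langle a_1,\dots,a_n\rangle$ be a numerical semigroup with $\gcd(\mathcal{S})=1$. If $\mathcal{S}$ does not have full normalescence rank, then there is a nonempty set $I\subseteq\{1,\dots,n\}$ such that \[ \sum_{i\in I}a_i\in\langle a_j : j\in\{1,\dots,n\}\setminus I\rangle . \]
   Context: Let $\mathbb{N}=\{0,1,2,\dots\}$. A numerical semigroup is a set $\mathcal{S}\subseteq\mathbb{N}$ that contains $0$ and is closed under addition. $\langle a_1,\dots,a_n\rangle=\{a_1x_1+\cdots+a_nx_n : x_i\in\mathbb{N}\}$ (with $\langle\,\rangle=\{0\}$ for the empty list). The embedding dimension $\mathsf{e}(\mathcal{S})$ is the number of elements of the unique minimal generating set of $\mathcal{S}$. A rational polyhedral cone in $\mathbb{R}^m$ is a pointed (containing no line) set of the form $\operatorname{cone}(\mathbf{v}_1,\dots,\mathbf{v}_\ell)=\{\sum_i\lambda_i\mathbf{v}_i:\lambda_i\in\mathbb{R}_{\ge 0}\}$ with $\mathbf{v}_i\in\mathbb{Z}^m$; its dimension is the dimension of its linear span. A numerical semigroup $\mathcal{S}$ is $k$-normalescent if $\mathcal{S}=\pi(\mathcal{C}\cap\mathbb{Z}^m)$ for some $m$, some $k$-dimensional rational polyhedral cone $\mathcal{C}\subseteq\mathbb{R}^m$, and some linear map $\pi:\mathbb{R}^m\to\mathbb{R}$ with integer coefficients. The normalescence rank of $\mathcal{S}$ is the smallest $k$ such that $\mathcal{S}$ is $k$-normalescent; it is always at most $\mathsf{e}(\mathcal{S})$,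 and $\mathcal{S}$ has full normalescence rank if its normalescence rank equals $\mathsf{e}(\mathcal{S})$. *)

(* Defs.v *)
From HB Require Import structures.
From mathcomp Require Import all_boot all_order all_algebra finmap.
From mathcomp Require Import classical_sets reals.

Set Implicit Arguments.
Unset Strict Implicit.
Unset Printing Implicit Defensive.

Import Order.TTheory GRing.Theory Num.Theory.

Local Open Scope classical_set_scope.
Local Open Scope ring_scope.

Definition numerical_semigroup (S : set nat) : Prop :=
  S 0%N /\ forall s t : nat, S s -> S t -> S (s + t)%N.

Definition generated (I : finType) (J : {set I}) (a : I -> nat) : set nat :=
  [set s | exists x : I -> nat, s = (\sum_(j in J) a j * x j)%N].

Definition is_gcd (S : set nat) (g : nat) : Prop :=
  (forall s, S s -> (g %| s)%N) /\
  (forall d, (forall s, S s -> (d %| s)%N) -> (d %| g)%N).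

Definition generates (A : {fset nat}) (S : set nat) : Prop :=
  S = generated [set: A]%SET (fun x : A => val x).

Definition minimal_generating_set (A : {fset nat}) (S : set nat) : Prop :=
  generates A S /\
  forall B : {fset nat}, (B `<=` A)%fset -> generates B S -> B = A.

Definition is_embedding_dimension (S : set nat) (e : nat) : Prop :=
  exists A : {fset nat}, minimal_generating_set A S /\ #|` A|%fset = e.

Definition cone (R : realType) (m l : nat) (v : 'I_l -> 'rV[int]_m) :
    set 'rV[R]_m :=
  [set x | exists lambda : 'I_l -> R, (forall i, 0 <= lambda i) /\
     x = \sum_(i < l) lambda i *: map_mx intr (v i)].

Definition pointed (R : realType) (m : nat) (C : set 'rV[R]_m) : Prop :=
  ~ exists p d : 'rV[R]_m, d != 0 /\ forall t : R, C (p + t *: d).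

Definition rational_polyhedral_cone (R : realType) (m : nat)
    (C : set 'rV[R]_m) : Prop :=
  pointed C /\ exists (l : nat) (v : 'I_l -> 'rV[int]_m), C = @cone R m l v.

Definition is_linear_span (R : realType) (m : nat) (C : set 'rV[R]_m)
    (U : {vspace 'rV[R]_m}) : Prop :=
  (forall x, C x -> x \in U) /\
  (forall W : {vspace 'rV[R]_m}, (forall x, C x -> x \in W) -> (U <= W)%VS).

Definition has_dimension (R : realType) (m : nat) (C : set 'rV[R]_m)
    (k : nat) : Prop :=
  exists U : {vspace 'rV[R]_m}, is_linear_span C U /\ \dim U = k.

Definition integer_points (R : realType) (m : nat) : set 'rV[R]_m :=
  [set x | forall j, x 0 j \is a Num.int].

(* A linear map R^m -> R is given by its coefficient vector c. *)
Definition integer_functional (R : realType) (m : nat) (c : 'rV[int]_m)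
    (x : 'rV[R]_m) : R :=
  \sum_(j < m) (c 0 j)%:~R * x 0 j.

(* The image of the lattice points lies in R, so S is compared with it through
   the embedding of nat in R. *)
Definition normalescent (R : realType) (k : nat) (S : set nat) : Prop :=
  exists (m : nat) (C : set 'rV[R]_m) (c : 'rV[int]_m),
    [/\ rational_polyhedral_cone C,
        has_dimension C k &
        [set s%:R | s in S] =
          integer_functional c @` (C `&` @integer_points R m)].

Definition is_normalescence_rank (R : realType) (S : set nat) (k : nat) :
    Prop :=
  normalescent R k S /\ forall k' : nat, normalescent R k' S -> (k <= k')%N.

Definition full_normalescence_rank (R : realType) (S : set nat) : Prop :=
  exists k : nat, is_normalescence_rank R S k /\ is_embedding_dimension S k.

(* Main.v *)
(* Suppose that no such I exists. Taking I to be a singleton shows that the a_i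
   are distinct and minimally generate S, so e(S) = n, and the orthant realises
   the rank n. If S were the image of the lattice points of a cone C of
   dimension k < n, choose lattice points p_i of C above the a_i. They are
   linearly dependent, hence dependent mod 2: for some nonempty O, half the sum
   of the p_i over O is again a lattice point of C. Its image lies in S, which
   gives sum_O a_i = sum_j 2 x_j a_j; cancelling a_j for each j in O with
   x_j > 0 leaves the relation wanted for I = {i in O : x_i = 0}, and I is
   nonempty since otherwise a sum of positive terms would vanish. *)

Require Import Defs.
From HB Require Import structures.
From mathcomp Require Import all_boot all_order all_algebra finmap.
From mathcomp Require Import boolp classical_sets reals.
Set Implicit Arguments.
Unset Strict Implicit.
Unset Printing Implicit Defensive.
Import Order.TTheory GRing.Theory Num.Theory.
Local Open Scope ring_scope.

(** * Linear algebra: dependence modulo 2 and a dimension bound *)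

(* If the reduction of P mod 2 had independent rows, some maximal minor of P
   would be odd, hence nonzero in F. *)
Lemma mod2_dependency (F : numFieldType) (n m : nat) (P : 'M[int]_(n, m)) :
  ~~ row_free (map_mx intr P : 'M[F]_(n, m)) ->
  exists2 O : {set 'I_n}, O != finset.set0 &
    forall j, (2 %| \sum_(i in O) P i j)%Z.
Proof.
set P2 : 'M['F_2]_(n, m) := map_mx intr P.
have [P2free|] := boolP (row_free P2).
  have P2full : row_full P2^T by rewrite /row_full mxrank_tr.
  have := fullrowsub_unit P2full; set f := fullrankfun _.
  rewrite /P2 map_trmx -map_mxsub unitmxE det_map_mx unitfE => det2.
  case/negP; rewrite /row_free -mxrank_tr eqn_leq rank_leq_col /=.
  have Pfull : row_full (rowsub f (map_mx intr P^T : 'M[F]_(m, n))).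
    rewrite row_full_unit -map_mxsub unitmxE det_map_mx unitfE intr_eq0.
    by apply: contraNneq det2 => ->.
  rewrite -[X in (X <= _)%N](eqP Pfull) map_trmx.
  by rewrite -[X in rowsub f X]mul1mx -mul_rowsub_mx mxrankM_maxr.
(* Otherwise some nonzero [u] satisfies [u *m P2 = 0]. Since 1 is the only nonzero element of the
   field with two elements, [u] is the indicator of its support, which serves as [O]. *)
rewrite -kermx_eq0 => /rowV0Pn[u /sub_kermxP uP2 u_neq0] _.
exists [set i | u 0 i != 0]%SET => [|j].
  have [i ui] := rV0Pn _ u_neq0.
  by apply/set0Pn; exists i; rewrite inE.
rewrite (dvdz_pcharf (pchar_Fp (isT : prime 2))) rmorph_sum /=.
move/matrixP/(_ 0 j)/eqP: uP2; rewrite !mxE.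
congr (_ == 0); rewrite (bigID (fun i => u 0 i != 0)) /= addrC big1 ?add0r.
  apply: eq_big => [i|i ui]; first by rewrite inE.
  rewrite mxE; case: (u 0 i) ui => -[|[|//]] ? // _.
  by rewrite -[RHS]mul1r; congr (_ * _); apply/val_inj.
by move=> i /negPn/eqP ->; rewrite mul0r.
Qed.

Lemma row_free_dim (F : fieldType) (n m : nat) (A : 'M[F]_(n, m))
    (U : {vspace 'rV[F]_m}) :
  row_free A -> (forall i, row i A \in U) -> (n <= \dim U)%N.
Proof.
move=> Afree AU; pose X := [tuple row i A | i < n].
have Xi (i : 'I_n) : X`_i = row i A by rewrite -tnth_nth tnth_mktuple.
have Xfree : free X.
  apply/freeP => k; under eq_bigr do rewrite Xi.
  move=> k0 i; have : (\row_i k i) *m A = 0 *m A.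
    by rewrite mul0mx mulmx_sum_row -[RHS]k0; apply: eq_bigr => j _; rewrite mxE.
  by move/(row_free_inj Afree)/rowP/(_ i); rewrite !mxE.
have /dimvS : (<<X>> <= U)%VS by apply/span_subvP => x /mapP[i _ ->]; apply: AU.
by rewrite (eqP Xfree) size_tuple.
Qed.

(** * Closure properties of generated sets *)

Section Generated.
Variables (I : finType) (J : {set I}) (a : I -> nat).

Lemma generated0 : generated J a 0%N.
Proof. by exists (fun=> 0%N); rewrite big1 // => j _; rewrite muln0. Qed.

Lemma generatedD s t :
  generated J a s -> generated J a t -> generated J a (s + t)%N.
Proof.
move=> [x ->] [y ->]; exists (fun i => x i + y i)%N.
by rewrite -big_split; apply: eq_bigr => j _; rewrite mulnDr.
Qed.

Lemma generatedM s k : generated J a s -> generated J a (s * k)%N.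
Proof.
move=> [x ->]; exists (fun i => x i * k)%N.
by rewrite big_distrl; apply: eq_bigr => j _; rewrite mulnA.
Qed.

Lemma generated_sum (K : finType) (A : {pred K}) (F : K -> nat) :
  (forall k, k \in A -> generated J a (F k)) ->
  generated J a (\sum_(k in A) F k)%N.
Proof.
move=> AF; apply: (big_ind (generated J a)) AF; first exact: generated0.
exact: generatedD.
Qed.

Lemma mem_generated j : j \in J -> generated J a (a j).
Proof.
move=> jJ; exists (fun i => i == j : nat).
rewrite (bigD1 j) //= eqxx muln1 big1 ?addn0 // => i /andP[_ /negPf->].
by rewrite muln0.
Qed.

End Generated.

Lemma generated_sub (I K : finType) (J : {set I}) (L : {set K})
    (a : I -> nat) (b : K -> nat) :
  (forall j, j \in J -> generated L b (a j)) ->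
  (generated J a `<=` generated L b)%classic.
Proof.
by move=> ab _ [x ->]; apply: generated_sum => j jJ; apply/generatedM/ab.
Qed.

(** * Cones and the orthant *)

Lemma coneD (R : realType) (m l : nat) (v : 'I_l -> 'rV[int]_m) x y :
  @cone R m l v x -> @cone R m l v y -> @cone R m l v (x + y).
Proof.
move=> [lx [lx0 ->]] [ly [ly0 ->]]; exists (fun i => lx i + ly i).
split=> [i|]; first by rewrite addr_ge0.
by rewrite -big_split; apply: eq_bigr => i _; rewrite scalerDl.
Qed.

Lemma coneZ (R : realType) (m l : nat) (v : 'I_l -> 'rV[int]_m) (t : R) x :
  0 <= t -> @cone R m l v x -> @cone R m l v (t *: x).
Proof.
move=> t0 [lx [lx0 ->]]; exists (fun i => t * lx i).
split=> [i|]; first by rewrite mulr_ge0.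
by rewrite scaler_sumr; apply: eq_bigr => i _; rewrite scalerA.
Qed.

Lemma cone0 (R : realType) (m l : nat) (v : 'I_l -> 'rV[int]_m) :
  @cone R m l v 0.
Proof.
by exists (fun=> 0); split=> //; rewrite big1 // => i _; rewrite scale0r.
Qed.

Lemma cone_sum (R : realType) (m l : nat) (v : 'I_l -> 'rV[int]_m)
    (K : finType) (A : {pred K}) (F : K -> 'rV[R]_m) :
  (forall k, k \in A -> @cone R m l v (F k)) ->
  @cone R m l v (\sum_(k in A) F k).
Proof.
by move=> AF; apply: (big_ind (@cone R m l v)) AF; [apply: cone0|apply: coneD].
Qed.

Lemma orthantP (R : realType) (n : nat) (x : 'rV[R]_n) :
  @cone R n n (delta_mx 0) x <-> forall i, 0 <= x 0 i.
Proof.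
have dE (lambda : 'I_n -> R) :
    \sum_(i < n) lambda i *: map_mx intr (delta_mx 0 i) = \row_i lambda i.
  rewrite [RHS]row_sum_delta; apply: eq_bigr => i _.
  by rewrite map_delta_mx mxE.
split=> [[lambda [lambda0 ->]] i|x0]; first by rewrite dE mxE.
by exists (x 0); split=> //; rewrite dE; apply/rowP => i; rewrite mxE.
Qed.

Lemma orthant_normalescent (R : realType) (n : nat) (a : 'I_n -> nat) :
  normalescent R n (generated [set: 'I_n]%SET a).
Proof.
exists n, (@cone R n n (delta_mx 0)), (\row_i (a i)%:Z); split.
- split; last by exists n, (delta_mx 0).
  move=> [p [d [/rV0Pn[j dj] line]]].
  (* At this parameter the [j]-th coordinate of the line is -1, so the line leaves the orthant. *)
  have /orthantP/(_ j) := line (- (p 0 j + 1) / d 0 j).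
  by rewrite !mxE divfK // opprD addrA subrr add0r oppr_ge0 ler10.
- exists fullv; split; last by rewrite dimvf /dim /= mul1n.
  (* The standard basis vectors lie in the orthant, so its span is the whole space. *)
  split=> [x _|W WC]; first exact: memvf.
  apply/subvP => x _; rewrite [x]row_sum_delta; apply: memv_suml => i _.
  apply/memvZ/WC/orthantP => j; rewrite mxE; exact: ler0n.
apply/seteqP; split=> [_ [s [x ->] <-]|_ [y [/orthantP y0 yZ] <-]].
  exists (\row_i (x i)%:R).
    split; first by apply/orthantP => i; rewrite mxE ler0n.
    by move=> i; rewrite mxE natr_int.
  rewrite /integer_functional natr_sum; apply: eq_big => [i|i _].
    by rewrite inE.
  by rewrite !mxE natrM.
have /boolp.choice[x yx] i : exists k : nat, y 0 i = k%:R.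
  by apply/natrP; rewrite natrEint yZ y0.
exists (\sum_(j in [set: 'I_n]%SET) a j * x j)%N; first by exists x.
rewrite /integer_functional natr_sum; apply: eq_big => [i|i _].
  by rewrite inE.
by rewrite mxE yx natrM.
Qed.

(** * Halving a sum of lattice points in a cone of small dimension *)

Lemma integer_functional_sum (R : realType) (m : nat) (c : 'rV[int]_m)
    (K : finType) (A : {pred K}) (F : K -> 'rV[R]_m) :
  integer_functional c (\sum_(k in A) F k) =
  \sum_(k in A) integer_functional c (F k).
Proof.
rewrite /integer_functional exchange_big; apply: eq_bigr => j _.
by rewrite summxE mulr_sumr.
Qed.

Lemma integer_functionalZ (R : realType) (m : nat) (c : 'rV[int]_m)
    (t : R) (x : 'rV[R]_m) :
  integer_functional c (t *: x) = t * integer_functional c x.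
Proof.
rewrite /integer_functional mulr_sumr; apply: eq_bigr => j _.
by rewrite mxE mulrCA.
Qed.

Lemma half_sum_generated (R : realType) (n k : nat) (a : 'I_n -> nat) :
  normalescent R k (generated [set: 'I_n]%SET a) -> (k < n)%N ->
  exists O : {set 'I_n}, exists2 s,
    O != finset.set0 /\ generated [set: 'I_n]%SET a s &
    (\sum_(i in O) a i = s * 2)%N.
Proof.
move=> [m [C [c [[_ [l [v ->]]] [U [[CU _] dimU]] imC]]]] lt_kn.
have /boolp.choice[p pP] (i : 'I_n) : exists p : 'rV[int]_m,
    @cone R m l v (map_mx intr p) /\
    integer_functional c (map_mx intr p : 'rV[R]_m) = (a i)%:R.
  have : [set s%:R | s in generated [set: 'I_n]%SET a]%classic ((a i)%:R : R).
    by exists (a i) => //; apply: mem_generated; rewrite inE.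
  rewrite imC => -[x [Cx xZ] xa].
  (* The lattice point is recast as an integer row, which can be reduced modulo 2. *)
  have /boolp.choice[y xy] j : exists z, x 0 j = z%:~R by apply/intrP/xZ.
  exists (\row_j y j).
  suff <- : x = map_mx intr (\row_j y j) by [].
  by apply/rowP => j; rewrite !mxE.
pose P : 'M[int]_(n, m) := \matrix_i p i.
have rowPE i : row i (map_mx intr P : 'M[R]_(n, m)) = map_mx intr (p i).
  by rewrite -map_row rowK.
(* The [n] rows lie in [U], whose dimension [k] is below [n]. *)
have : ~~ row_free (map_mx intr P : 'M[R]_(n, m)).
  apply: contraL lt_kn => Pfree; rewrite -leqNgt -dimU.
  apply: row_free_dim Pfree _ => i.
  by rewrite rowPE; apply/CU; have [] := pP i.
case/mod2_dependency => O O_neq0 O2.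
(* The coordinates of [q] are integers by [O2]; [q] stays in the cone, which is closed under sums
   and nonnegative scaling. *)
pose q : 'rV[R]_m := 2^-1 *: \sum_(i in O) map_mx intr (p i).
have qZ : integer_points q.
  move=> j; rewrite !mxE summxE; have /dvdzP[z Oz] := O2 j.
  have -> : \sum_(i in O) map_mx intr (p i) 0 j = z%:~R * 2 :> R.
    rewrite -(intrM _ z 2) -Oz rmorph_sum /=.
    by apply: eq_bigr => i _; rewrite !mxE.
  by rewrite mulrC mulfK ?pnatr_eq0 // intr_int.
have Cq : @cone R m l v q.
  apply: coneZ; first by rewrite invr_ge0.
  by apply: cone_sum => i _; have [] := pP i.
have : [set s%:R | s in generated [set: 'I_n]%SET a]%classic
         (integer_functional c q) by rewrite imC; exists q.
case=> s Ss sq; exists O, s => //.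
apply/eqP; rewrite -(eqr_nat R) natrM sq integer_functionalZ mulrC.
rewrite mulVKf ?pnatr_eq0 // integer_functional_sum natr_sum; apply/eqP.
by apply: eq_bigr => i _; have [_ ->] := pP i.
Qed.

(** * From the doubled relation to the set [I] *)

Lemma sum_generated_compl (n : nat) (a : 'I_n -> nat) (O : {set 'I_n}) s :
  (forall i, 0 < a i)%N -> O != finset.set0 ->
  generated [set: 'I_n]%SET a s -> (\sum_(i in O) a i = s * 2)%N ->
  exists I : {set 'I_n},
    I <> finset.set0 /\ generated (~: I)%SET a (\sum_(i in I) a i)%N.
Proof.
move=> a_gt0 O_neq0 [x ->] Ox.
pose I := [set i in O | x i == 0]%SET.
(* Cancel one copy of a i for each i in O with x i > 0. *)
pose y i := (x i * 2 - (i \in O))%N.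
have sumI : (\sum_(i in I) a i = \sum_(i in ~: I) a i * y i)%N.
  apply: (@addnI (\sum_(i | (i \in O) && (i \notin I)) a i)%N).
  transitivity (\sum_(i in O) a i)%N.
    rewrite [RHS](bigID (mem I)) addnC; congr addn; apply: eq_bigl => i /=.
    by rewrite inE; case: (i \in O).
  (* The two sides agree term by term: for [i] in [O] but not in [I], [x i] is positive, so the
     truncated subtraction in [y i] is exact. *)
  rewrite Ox big_distrl big_mkcond [X in (X + _)%N]big_mkcond.
  rewrite [X in (_ + X)%N]big_mkcond -big_split; apply: eq_bigr => i _.
  rewrite /= /y !inE.
  case: (i \in O) (x i) => -[|k] //=; rewrite ?muln0 ?mul0n ?subn0 ?mulnA //.
  by rewrite -mulnS -mulnA.
exists I; split; last by exists y.
(* If [I] is empty, [sumI] makes every [a i * y i] vanish, but for [i] in [O] both factors are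
   positive, as [y i] is then odd. *)
move=> I0; have [i Oi] := set0Pn _ O_neq0; move: sumI.
rewrite I0 big_set0 => /esym/eqP; rewrite sum_nat_eq0 => /forallP/(_ i).
have : i \notin I by rewrite I0 inE.
rewrite !inE Oi /y Oi /= muln_eq0 -leqn0 leqNgt a_gt0 /=.
by case: (x i).
Qed.

Lemma embedding_dimension_independent (n : nat) (a : 'I_n -> nat) :
  (forall i, ~ generated (~: [set i])%SET a (a i)) ->
  is_embedding_dimension (generated [set: 'I_n]%SET a) n.
Proof.
move=> a_indep.
have a_inj : injective a.
  move=> i j aij; apply/eqP/negP => /negP ij; case: (a_indep i); rewrite aij.
  by apply: mem_generated; rewrite !inE eq_sym.
pose A := [fset a i | i in 'I_n]%fset.
exists A; split; last by rewrite card_imfset //= -cardE card_ord.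
split=> [|B BA SB].
  apply/seteqP; split.
    apply: generated_sub => i _; have aA : a i \in A by apply/imfsetP; exists i.
    by rewrite -[a i]/(val [` aA]%fset); apply: mem_generated.
  apply: generated_sub => -[s sA] _ /=.
  by have /imfsetP[i _ ->] := sA; apply: mem_generated.
apply/eqP; rewrite eqEfsubset BA; apply/fsubsetP => _ /imfsetP[i _ ->].
(* If [a i] were missing from [B], every element of [B] would be some [a j] with [j] different from
   [i], so the other values would generate [a i]. *)
apply/negP => aB; apply: (a_indep i).
have : generated [set: 'I_n]%SET a (a i) by apply: mem_generated.
rewrite SB; apply: generated_sub => -[s sB] _ /=.
have /imfsetP[j _ sj] := fsubsetP BA _ sB; rewrite sj; apply: mem_generated.
by rewrite !inE; apply/eqP => ji; apply: aB; rewrite -ji -sj.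
Qed.
Local Close Scope ring_scope.

Theorem corollary3p2 (R : realType) (n : nat) (a : 'I_n -> nat) (S : set nat)
    (a_gt0 : forall i : 'I_n, 0 < a i)
    (S_semigroup : numerical_semigroup S)
    (S_gen : S = generated [set: 'I_n]%SET a)
    (S_gcd : is_gcd S 1)
    (S_not_full : ~ full_normalescence_rank R S) :
  exists I : {set 'I_n},
    I <> finset.set0 /\ generated (~: I)%SET a (\sum_(i in I) a i).
Proof.
apply: contrapT => noI; apply: S_not_full; rewrite S_gen.
exists n; split; last first.
  (* A generator redundant among the others gives the relation for a singleton [I]. *)
  apply: embedding_dimension_independent => i ai; apply: noI; exists [set i]%SET.
  by split; [apply/eqP/set0Pn; exists i; rewrite inE | rewrite big_set1].
split=> [|k Sk]; first exact: orthant_normalescent.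
rewrite leqNgt; apply/negP => lt_kn; apply: noI.
have [O [s [O_neq0 Ss] Os]] := half_sum_generated Sk lt_kn.
exact: sum_generated_compl Ss Os.
Qed.
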